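(* Let $T$ and $M$ be smooth real manifolds with $\dim T=p\geq 2$ and $\dim M=n$, let $h=(h_{\alpha\beta}(t))$ be a fixed semi-Riemannian metric on $T$, and let $L:J^1(T,M)\to\mathbb{R}$ be a smooth function. Then the following statements are equivalent: (i) $L$ is a Kronecker $h$-regular multi-time Lagrangian function on $J^1(T,M)$. (ii) $L$ is a non-autonomous electrodynamics Lagrangian function, that is, $$L=h^{\alpha\beta}(t)\,g_{ij}(t,x)\,x^i_\alpha x^j_\beta+U^{(\alpha)}_{(i)}(t,x)\,x^i_\alpha+F(t,x),$$ where $g_{ij}(t,x)$ is a d-tensor field on $J^1(T,M)$ depending only on $(t,x)$, symmetric, of rank $n$ and of constant signature, $U^{(\alpha)}_{(i)}(t,x)$ is a d-tensor field on $J^1(T,M)$ depending only on $(t,x)$, and $F:T\times M\to\mathbb{R}$ is a smooth function.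
   Context: Greek indices run from $1$ to $p$, Latin indices from $1$ to $n$; repeated indices are summed. $T$ has local coordinates $(t^\alpha)$, $M$ has local coordinates $(x^i)$, and $J^1(T,M)\to T\times M$ is the first-order jet bundle with induced coordinates $(t^\alpha,x^i,x^i_\alpha)$, which change by $$\tilde t^\alpha=\tilde t^\alpha(t^\beta),\qquad \tilde x^i=\tilde x^i(x^j),\qquad \tilde x^i_\alpha=\frac{\partial\tilde x^i}{\partial x^j}\frac{\partial t^\beta}{\partial\tilde t^\alpha}x^j_\beta .$$ $(h^{\alpha\beta})$ denotes the inverse matrix of $(h_{\alpha\beta})$. A d-tensor on $J^1(T,M)$ is a family of local functions on $J^1(T,M)$ transforming tensorially under these changes of coordinates: for $g_{ij}$, $g_{ij}=\tilde g_{kl}\frac{\partial\tilde x^k}{\partial x^i}\frac{\partial\tilde x^l}{\partial x^j}$; for $U^{(\alpha)}_{(i)}$, $U^{(\alpha)}_{(i)}=\tilde U^{(\beta)}_{(j)}\frac{\partial\tilde x^j}{\partial x^i}\frac{\partial t^\alpha}{\partial\tilde t^\beta}$. A smooth function $L:J^1(T,M)\to\mathbb{R}$ is called a Kronecker $h$-regular multi-time Lagrangian function if its vertical fundamental metrical d-tensor has the form $$G^{(\alpha)(\beta)}_{(i)(j)}:=\frac12\frac{\partial^2L}{\partial x^i_\alpha\partial x^j_\beta}=h^{\alpha\beta}(t^\gamma)\,g_{ij}(t^\gamma,x^k,x^k_\gamma)$$ for some d-tensor $g_{ij}(t^\gamma,x^k,x^k_\gamma)$ on $J^1(T,M)$ which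 is symmetric, of rank $n$, and of constant signature. *)

(* Defs.v *)
From HB Require Import structures.
From mathcomp Require Import all_boot all_order all_algebra.
From mathcomp Require Import boolp classical_sets functions reals.
From mathcomp Require Import topology normedtype derive.

Set Implicit Arguments.
Unset Strict Implicit.
Unset Printing Implicit Defensive.

Import Order.TTheory GRing.Theory Num.Theory.
Import numFieldNormedType.Exports.

Local Open Scope classical_set_scope.
Local Open Scope ring_scope.

(* Meant for open A, where 'D_v does not see values of f outside A. *)
Fixpoint Ck_on (R : realType) (V W : normedModType R) (k : nat)
    (A : set V) (f : V -> W) : Prop :=
  if k is k'.+1 then
    (forall x, A x -> differentiable f x) /\ (forall v, Ck_on k' A ('D_v f))
  else forall x, A x -> {for x, continuous f}.

Definition smooth_on (R : realType) (V W : normedModType R)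
  (A : set V) (f : V -> W) : Prop := forall k, Ck_on k A f.

(* The atlas is arbitrary (it may be the maximal one).  [cpt a] is the inverse
   of the chart [crd a]; only its values on [crd a @` cdom a] matter. *)
Record smooth_manifold (R : realType) (n : nat) := SmoothManifold {
  mfd_point :> topologicalType;
  mfd_hausdorff : hausdorff_space mfd_point;
  mfd_second_countable : @second_countable mfd_point;
  chart : Type;
  cdom : chart -> set mfd_point;
  crd : chart -> mfd_point -> 'rV[R]_n;
  cpt : chart -> 'rV[R]_n -> mfd_point;
  cdom_cover : forall y, exists a, cdom a y;
  cdom_open : forall a, open (cdom a);
  cimg_open : forall a, open (crd a @` cdom a);
  crdK : forall a y, cdom a y -> cpt a (crd a y) = y;
  crd_continuous : forall a y, cdom a y -> {for y, continuous (crd a)};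
  cpt_continuous : forall a z, (crd a @` cdom a) z ->
    {for z, continuous (cpt a)};
  transition_smooth : forall a a',
    smooth_on (crd a @` (cdom a `&` cdom a')) (crd a' \o cpt a)
}.

Definition cimg (R : realType) (n : nat) (X : smooth_manifold R n)
  (a : chart X) : set 'rV[R]_n := crd a @` cdom a.

(* Jacobian at y of the change of coordinates from a to a'.  The library's 'J
   acts on row vectors: the entry (i, k) is d x'^k / d x^i, where x and x' are
   the coordinates of a and a'. *)
Definition cjac (R : realType) (n : nat) (X : smooth_manifold R n)
  (a a' : chart X) (y : X) : 'M[R]_n := jacobian (crd a' \o cpt a) (crd a y).

Lemma jacobian_comp_near (R : realType) (l m n : nat) (k : 'rV[R]_l -> 'rV[R]_n)
    (f : 'rV[R]_l -> 'rV[R]_m) (g : 'rV[R]_m -> 'rV[R]_n) (x : 'rV[R]_l) :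
  differentiable f x -> differentiable g (f x) ->
  (\forall z \near x, k z = (g \o f) z) -> differentiable k x ->
  jacobian k x = jacobian f x *m jacobian g (f x).
Proof.
move=> df dg kgf dk.
have dc := differentiable_comp df dg.
apply/row_matrixP => i; rewrite row_mul !rowE.
rewrite -(deriveEjacobian _ dk) -(deriveEjacobian _ df) -(deriveEjacobian _ dg).
by rewrite (near_eq_derive _ kgf) !deriveE // (diff_comp df dg).
Qed.

Lemma cjac_comp (R : realType) (n : nat) (X : smooth_manifold R n)
    (a a' a'' : chart X) (y : X) :
  cdom a y -> cdom a' y -> cdom a'' y ->
  cjac a a'' y = cjac a a' y *m cjac a' a'' y.
Proof.
move=> ay a'y a''y; rewrite /cjac.
have da : differentiable (crd a' \o cpt a) (crd a y).
  by have [+ _] := transition_smooth a a' 1%N; apply; exists y.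
have da' : differentiable (crd a'' \o cpt a') (crd a' y).
  by have [+ _] := transition_smooth a' a'' 1%N; apply; exists y.
have da'' : differentiable (crd a'' \o cpt a) (crd a y).
  by have [+ _] := transition_smooth a a'' 1%N; apply; exists y.
have e : (crd a' \o cpt a) (crd a y) = crd a' y by rewrite /= crdK.
have da'e : differentiable (crd a'' \o cpt a') ((crd a' \o cpt a) (crd a y)).
  by rewrite e.
have near_tr : \forall z \near crd a y, (crd a'' \o cpt a) z =
    ((crd a'' \o cpt a') \o (crd a' \o cpt a)) z.
  have cy : {for crd a y, continuous (cpt a)}.
    by apply: cpt_continuous; exists y.
  have n' : nbhs (cpt a (crd a y)) (cdom a').
    by rewrite crdK //; apply: open_nbhs_nbhs; split => //; exact: cdom_open.
  have n'' : nbhs (crd a y) (cpt a @^-1` cdom a') by exact: cy n'.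
  by apply: filterS n'' => z za' /=; rewrite crdK.
rewrite -[in RHS]e; exact: jacobian_comp_near da da'e near_tr da''.
Qed.

Lemma cjac_id (R : realType) (n : nat) (X : smooth_manifold R n)
    (a : chart X) (y : X) : cdom a y -> cjac a a y = 1%:M.
Proof.
move=> ay; rewrite /cjac.
have near_id : \forall z \near crd a y, (crd a \o cpt a) z = id z.
  have : nbhs (crd a y) (crd a @` cdom a).
    by apply: open_nbhs_nbhs; split; [exact: cimg_open|exists y].
  by apply: filterS => _ [t at_ <-] /=; rewrite crdK.
have da : differentiable (crd a \o cpt a) (crd a y).
  by have [+ _] := transition_smooth a a 1%N; apply; exists y.
apply/row_matrixP => i; rewrite !rowE mulmx1 -(deriveEjacobian _ da).
by rewrite (near_eq_derive _ near_id) derive_id.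
Qed.

(* Sylvester: A is congruent to diag(1,..,1,-1,..,-1,0,..,0), with r ones and
   s minus ones. *)
Definition has_signature (R : realType) (n : nat) (r s : nat) (A : 'M[R]_n) :=
  (r + s <= n)%N /\
  exists2 P : 'M[R]_n, P \in unitmx &
    P *m A *m P^T =
      diag_mx (\row_i (if (i < r)%N then 1 else if (i < r + s)%N then -1 else 0)).

(* [h a t] is the matrix of components at t in the chart a. *)
Record semi_riemannian_metric (R : realType) (p : nat)
    (T : smooth_manifold R p) := SemiRiemannianMetric {
  metric :> chart T -> T -> 'M[R]_p;
  metric_smooth : forall a, smooth_on (cimg a) (metric a \o cpt a);
  metric_change : forall a a' t, cdom a t -> cdom a' t ->
    forall al be, metric a t al be =
      \sum_ga \sum_de metric a' t ga de * cjac a a' t al ga * cjac a a' t be de;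
  metric_sym : forall a t, cdom a t -> (metric a t)^T = metric a t;
  metric_nondegenerate : forall a t, cdom a t -> metric a t \in unitmx;
  metric_signature : exists r s, forall a t, cdom a t ->
    has_signature r s (metric a t)
}.

Section Jets.
Variables (R : realType) (p n : nat).
Variables (T : smooth_manifold R p) (M : smooth_manifold R n).

(* An element of the fibre of J^1(T,M) over (t,x) is given by its coordinates
   (x^i_al), one matrix (row al, column i) for every pair of charts around t
   and x, obeying the law of change of coordinates.  The matrix is set to 0 for
   the charts that do not contain (t,x), so that equal jets are Leibniz equal. *)
Record jet1 := Jet1 {
  jsrc : T;
  jtgt : M;
  jmx : chart T -> chart M -> 'M[R]_(p, n);
  jmx_change : forall a a' b b',
    cdom a jsrc -> cdom a' jsrc -> cdom b jtgt -> cdom b' jtgt ->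
    jmx a' b' = cjac a' a jsrc *m jmx a b *m cjac b b' jtgt;
  jmx_off : forall a b, ~ (cdom a jsrc /\ cdom b jtgt) -> jmx a b = 0
}.

Definition jdom (a : chart T) (b : chart M) : set jet1 :=
  [set j | cdom a (jsrc j) /\ cdom b (jtgt j)].

(* Local coordinates ((t^al), (x^i), (x^i_al)). *)
Definition jspace := ('rV[R]_p * 'rV[R]_n * 'M[R]_(p, n))%type.

Definition jimg (a : chart T) (b : chart M) : set jspace :=
  [set z | cimg a z.1.1 /\ cimg b z.1.2].

Definition jcrd (a : chart T) (b : chart M) (j : jet1) : jspace :=
  (crd a (jsrc j), crd b (jtgt j), jmx j a b).

(* The inverse of jcrd a b; only its values on jimg a b matter. *)
Definition jpt_mx (a : chart T) (b : chart M) (z : jspace)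
    (a' : chart T) (b' : chart M) : 'M[R]_(p, n) :=
  let t := cpt a z.1.1 in let x := cpt b z.1.2 in
  if `[< (cdom a t /\ cdom b x) /\ (cdom a' t /\ cdom b' x) >]
  then cjac a' a t *m z.2 *m cjac b b' x else 0.

Lemma jpt_mx_change a b z a1 a2 b1 b2 :
  cdom a1 (cpt a z.1.1) -> cdom a2 (cpt a z.1.1) ->
  cdom b1 (cpt b z.1.2) -> cdom b2 (cpt b z.1.2) ->
  jpt_mx a b z a2 b2 =
    cjac a2 a1 (cpt a z.1.1) *m jpt_mx a b z a1 b1 *m cjac b1 b2 (cpt b z.1.2).
Proof.
rewrite /jpt_mx; set t := cpt a _; set x := cpt b _ => h1 h2 k1 k2.
case: asboolP => [[[ha hb] _]|h]; case: asboolP => [h'|h'].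
- rewrite (cjac_comp h2 h1 ha) (cjac_comp hb k1 k2) !mulmxA //.
- by case: h'.
- by case: h; case: h'.
- by rewrite mulmx0 mul0mx.
Qed.

Lemma jpt_mx_off a b z a' b' :
  ~ (cdom a' (cpt a z.1.1) /\ cdom b' (cpt b z.1.2)) -> jpt_mx a b z a' b' = 0.
Proof. by move=> h; rewrite /jpt_mx; case: asboolP => // -[]. Qed.

Definition jpt (a : chart T) (b : chart M) (z : jspace) : jet1 :=
  Jet1 (@jpt_mx_change a b z) (@jpt_mx_off a b z).

Lemma jptK a b z : jimg a b z -> jcrd a b (jpt a b z) = z.
Proof.
case: z => -[_ _] v [/= [t at_ <-] [x bx <-]].
rewrite /jcrd /= /jpt_mx /= !crdK //; case: asboolP => [_|[]//].
by rewrite !cjac_id // mul1mx mulmx1.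
Qed.

Lemma jet1_eq j j' :
  jsrc j = jsrc j' -> jtgt j = jtgt j' -> jmx j = jmx j' -> j = j'.
Proof.
case: j j' => [t x v cv ov] [t' x' v' cv' ov'] /= et ex ev; subst t' x' v'.
by congr Jet1; exact: Prop_irrelevance.
Qed.

Lemma jcrdK a b j : jdom a b j -> jpt a b (jcrd a b j) = j.
Proof.
move=> [ha hb]; apply: jet1_eq; rewrite /= ?crdK //.
apply/funext => a'; apply/funext => b'; rewrite /jpt_mx /= !crdK //.
case: asboolP => [[_ [ha' hb']]|h].
  by rewrite -(jmx_change ha ha' hb hb').
by rewrite jmx_off // => h'; apply: h.
Qed.

Definition jet_smooth_on (W : normedModType R) (a : chart T) (b : chart M)
  (f : jet1 -> W) : Prop := smooth_on (jimg a b) (f \o jpt a b).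

Definition jet_smooth (L : jet1 -> R) : Prop :=
  forall a b, jet_smooth_on a b L.

Definition base_smooth (F : T * M -> R) : Prop :=
  forall (a : chart T) (b : chart M),
    smooth_on [set z : 'rV[R]_p * 'rV[R]_n | cimg a z.1 /\ cimg b z.2]
      (fun z => F (cpt a z.1, cpt b z.2)).

(* d-tensors on J^1(T,M): one local function on each coordinate domain
   [jdom a b] (values off the domain are irrelevant). *)
Definition dtensor_g (g : chart T -> chart M -> jet1 -> 'M[R]_n) : Prop :=
  (forall a b, jet_smooth_on a b (g a b)) /\
  (forall a a' b b' y, jdom a b y -> jdom a' b' y ->
    forall i j, g a b y i j =
      \sum_k \sum_l
        g a' b' y k l * cjac b b' (jtgt y) i k * cjac b b' (jtgt y) j l).

(* Row al, column i. *)
Definition dtensor_U (U : chart T -> chart M -> jet1 -> 'M[R]_(p, n)) : Prop :=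
  (forall a b, jet_smooth_on a b (U a b)) /\
  (forall a a' b b' y, jdom a b y -> jdom a' b' y ->
    forall al i, U a b y al i =
      \sum_be \sum_j
        U a' b' y be j * cjac b b' (jtgt y) i j * cjac a' a (jsrc y) be al).

Definition base_only (W : Type) (f : chart T -> chart M -> jet1 -> W) : Prop :=
  forall a b y y', jdom a b y -> jdom a b y' ->
    jsrc y = jsrc y' -> jtgt y = jtgt y' -> f a b y = f a b y'.

Definition sym_rank_signature (g : chart T -> chart M -> jet1 -> 'M[R]_n) :=
  [/\ forall a b y, jdom a b y -> (g a b y)^T = g a b y,
      forall a b y, jdom a b y -> \rank (g a b y) = n
    & exists r s, forall a b y, jdom a b y -> has_signature r s (g a b y)].

(* The direction of the coordinate x^i_al. *)
Definition vdir (al : 'I_p) (i : 'I_n) : jspace := (0, 0, delta_mx al i).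

Definition vertical_metric (L : jet1 -> R) (a : chart T) (b : chart M)
    (y : jet1) (al be : 'I_p) (i j : 'I_n) : R :=
  2^-1 * 'D_(vdir al i) ('D_(vdir be j) (L \o jpt a b)) (jcrd a b y).

Definition kronecker_regular (h : semi_riemannian_metric T) (L : jet1 -> R) :=
  exists g : chart T -> chart M -> jet1 -> 'M[R]_n,
    [/\ dtensor_g g, sym_rank_signature g
      & forall a b y, jdom a b y -> forall al be i j,
          vertical_metric L a b y al be i j =
            invmx (h a (jsrc y)) al be * g a b y i j].

Definition electrodynamics (h : semi_riemannian_metric T) (L : jet1 -> R) :=
  exists (g : chart T -> chart M -> jet1 -> 'M[R]_n)
         (U : chart T -> chart M -> jet1 -> 'M[R]_(p, n)) (F : T * M -> R),
    [/\ [/\ dtensor_g g, base_only g & sym_rank_signature g],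
        dtensor_U U /\ base_only U,
        base_smooth F
      & forall a b y, jdom a b y ->
          L y = \sum_al \sum_be \sum_i \sum_j
                  invmx (h a (jsrc y)) al be * g a b y i j *
                  jmx y a b al i * jmx y a b be j
              + \sum_al \sum_i U a b y al i * jmx y a b al i
              + F (jsrc y, jtgt y)].

End Jets.

(* Main.v *)
(* Fix (t,x) and put Phi_{mu j} = sum_be h_{be mu} dL/dx^j_be.  Regularity gives
   dPhi_{mu j}/dx^i_al = 2 delta_{al mu} g_ij, so Phi_{mu j}, and with it g_ij,
   depends on the row mu of (x^i_al) only.  As p >= 2, taking two different mu
   shows that g_ij does not depend on (x^i_al) at all, whence L is a quadratic
   polynomial on each fibre with leading part h^{al be} g_ij x^i_al x^j_be; U is
   its derivative along the zero section and F its restriction to that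
   section. *)

Require Import Defs.
From mathcomp Require Import all_boot all_order all_algebra.
From mathcomp Require Import ring lra.
From mathcomp Require Import boolp classical_sets functions reals.
From mathcomp Require Import topology normedtype derive.
From mathcomp Require Import landau realfun.

Set Implicit Arguments.
Unset Strict Implicit.
Unset Printing Implicit Defensive.

Import Order.TTheory GRing.Theory Num.Theory.
Import numFieldNormedType.Exports.

Local Open Scope classical_set_scope.
Local Open Scope ring_scope.

(** * Calculus of real functions restricted to an affine line *)

(** The equality is between the difference quotients themselves, before any limit, so that it yields
    both the value of the derivative and derivability. *)
Lemma growth_line (R : realType) (V : normedModType R) (F : V -> R) (z w : V)
    (s : R) :
  (fun k => k^-1 *: (((fun r : R => F (z + r *: w)) \o shift s) (k *: 1)
                      - F (z + s *: w))) =
  (fun k => k^-1 *: ((F \o shift (z + s *: w)) (k *: w) - F (z + s *: w))).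
Proof.
apply/funext => k; rewrite /= /shift /=; congr (_ *: (F _ - _)).
by rewrite scalerDl [k *: 1]mulr1 [LHS]addrCA.
Qed.

Lemma derive_line (R : realType) (V : normedModType R) (F : V -> R) (z w : V)
    (s : R) :
  'D_1 (fun r : R => F (z + r *: w)) s = 'D_w F (z + s *: w).
Proof. by rewrite /derive growth_line. Qed.

Lemma derivable_line (R : realType) (V : normedModType R) (F : V -> R)
    (z w : V) (s : R) :
  derivable (fun r : R => F (z + r *: w)) s 1 <-> derivable F (z + s *: w) w.
Proof. by rewrite /derivable growth_line. Qed.

(** Subtracting the polynomial [s * c + s ^+ 2 * d] from [F] on the line leaves a function of [s]
    with zero derivative; its values at 1 and 0 therefore agree. *)
Lemma line_quadratic (R : realType) (V : normedModType R) (F : V -> R)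
    (z w : V) (c d : R) :
  (forall s, differentiable F (z + s *: w)) ->
  (forall s, 'D_w F (z + s *: w) = c + s * d *+ 2) -> F (z + w) = F z + c + d.
Proof.
move=> dF DF.
pose k (s : R) := F (z + s *: w) - (s * c + s ^+ 2 * d).
have dk (s : R) : is_derive s (1 : R) k 0.
  have d1 : is_derive s (1 : R) (fun r : R => F (z + r *: w)) (c + s * d *+ 2).
    split; first by apply/derivable_line; exact: diff_derivable.
    by rewrite derive_line DF.
  have d2 : is_derive s (1 : R) (fun r : R => r * c + r ^+ 2 * d)
      (c + s * d *+ 2).
    (* Read as the evaluation of a polynomial, the function is differentiated by the formal rules
       for polynomials. *)
    have -> : (fun r : R => r * c + r ^+ 2 * d) =
        horner (c *: 'X + d *: 'X^2).
      by apply/funext => r; rewrite hornerD !hornerZ hornerXn hornerX; ring.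
    apply: is_derive_eq.
    rewrite derivD !derivZ derivX derivXn hornerD !hornerZ hornerC hornerMn.
    by rewrite hornerXn expr1 -mulr_natl; ring.
  rewrite -[X in is_derive _ _ _ X](subrr (c + s * d *+ 2)).
  exact: is_deriveB.
have := is_derive_0_is_cst 1 0 dk.
rewrite /k scale1r scale0r addr0 mul1r mul0r expr1n expr0n mul1r mul0r => e.
by apply/eqP; rewrite -subr_eq0; apply/eqP; move: e; lra.
Qed.

Lemma line_constant (R : realType) (V : normedModType R) (F : V -> R)
    (z w : V) :
  (forall s, differentiable F (z + s *: w)) ->
  (forall s, 'D_w F (z + s *: w) = 0) -> F (z + w) = F z.
Proof.
move=> dF DF; rewrite (@line_quadratic _ _ F z w 0 0) ?addr0 // => s.
by rewrite DF mulr0 mul0rn addr0.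
Qed.

(** On the line [F] is a polynomial in [s], and its derivative at 0 is the linear coefficient. This
    computes Hessians in the direction from (ii) to (i). *)
Lemma derive_of_line_quadratic (R : realType) (V : normedModType R)
    (F : V -> R) (z w : V) (c d : R) :
  (forall s, F (z + s *: w) = F z + s * c + s ^+ 2 * d) -> 'D_w F z = c.
Proof.
move=> eF; rewrite -[z in LHS]addr0 -(scale0r w) -derive_line.
have -> : (fun r : R => F (z + r *: w)) =
    horner ((F z)%:P + c *: 'X + d *: 'X^2).
  apply/funext => r.
  by rewrite eF !hornerD hornerC !hornerZ hornerXn hornerX; ring.
rewrite -derive1E -derivE.
rewrite 2!derivD derivC !derivZ derivX derivXn add0r hornerD !hornerZ hornerC.
by rewrite hornerMn hornerXn expr1 mul0rn mulr0 addr0 mulr1.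
Qed.

(** * Stability of differentiability and of the classes C^k *)

(** The first-order expansion only involves the germ at [x], so the differential of [f] serves for
    [g], and uniqueness identifies it with that of [g]. *)
Lemma near_eq_differentiable (R : numFieldType) (V W : normedModType R)
    (f g : V -> W) (x : V) :
  (\forall y \near x, f y = g y) -> differentiable f x -> differentiable g x.
Proof.
move=> fg df.
have fgx : f x = g x by exact: nbhs_singleton fg.
have dg : g \o shift x = cst (g x) + 'd f x +o_ 0 id.
  have /eqaddoP fo := diff_locally df.
  have fg0 : \forall h \near (0 : V), f (h + x) = g (h + x).
    by move: fg; rewrite (near_shift 0) subr0.
  apply/eqaddoP => e e0; near=> h; rewrite !fctE /shift.
  have <- : f (h + x) = g (h + x) by near: h.
  rewrite -fgx.
  by near: h; exact: fo.
apply/diff_locallyP; rewrite (diff_unique (diff_continuous df) dg).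
by split=> //; exact: diff_continuous.
Unshelve. all: by end_near. Qed.

(** As [A] is open, equality on [A] is equality near each of its points; it is thus inherited by
    directional derivatives, and the induction on [k] goes through. *)
Lemma Ck_on_ext (R : realType) (V W : normedModType R) k (A : set V)
    (f g : V -> W) : open A -> {in A, f =1 g} -> Ck_on k A f -> Ck_on k A g.
Proof.
move=> oA; elim: k f g => [|k IH] f g fg.
  move=> cf x Ax; rewrite /prop_for /continuous_at -fg ?inE //.
  apply: cvg_trans (cf x Ax); apply: near_eq_cvg.
  have nA : nbhs x A by exact: open_nbhs_nbhs.
  by apply: filterS nA => y Ay; rewrite fg ?inE.
have nfg x : A x -> \forall y \near x, f y = g y.
  move=> Ax; have nA : nbhs x A by exact: open_nbhs_nbhs.
  by apply: filterS nA => y Ay; rewrite fg ?inE.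
move=> [df Df]; split=> [x Ax|v].
  exact: near_eq_differentiable (nfg _ Ax) (df _ Ax).
apply: IH (Df v) => x; rewrite inE => Ax.
exact: near_eq_derive (nfg _ Ax).
Qed.

(** Being its own differential everywhere is how [pi] is said to be continuous linear. Then
    ['D_v (f \o pi)] is ['D_(pi v) f \o pi] on the preimage of [A], which has the same shape one
    order lower. *)
Lemma Ck_on_comp_linl (R : realType) (V V' W : normedModType R) k (A : set V)
    (pi : V' -> V) (f : V -> W) : open A -> (forall x, is_diff x pi pi) ->
  Ck_on k A f -> Ck_on k (pi @^-1` A) (f \o pi).
Proof.
move=> oA dpi.
have opi : open (pi @^-1` A).
  apply: open_comp => // x _; apply: differentiable_continuous.
  exact: ex_diff.
elim: k f => [|k IH] f.
  move=> cf x Ax; apply: continuous_comp; last exact: cf.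
  by apply: differentiable_continuous; exact: ex_diff.
move=> [df Df]; split=> [x Ax|v].
  apply: differentiable_comp; first exact: ex_diff.
  exact: df.
apply: Ck_on_ext (IH _ (Df (pi v))) => // x; rewrite inE => Ax /=.
have dpx : differentiable pi x by exact: ex_diff.
have dfx : differentiable f (pi x) by exact: df.
rewrite !deriveE //; last exact: differentiable_comp.
have dE : 'd pi x = pi :> (V' -> V) by exact: diff_val.
by rewrite [in RHS]diff_comp //= dE.
Qed.

(** Here the induction rests on ['D_v (l \o f)] being [l \o 'D_v f] on [A]. *)
Lemma Ck_on_comp_linr (R : realType) (V W W' : normedModType R) k (A : set V)
    (l : W -> W') (f : V -> W) : open A -> (forall x, is_diff x l l) ->
  Ck_on k A f -> Ck_on k A (l \o f).
Proof.
move=> oA dl; elim: k f => [|k IH] f.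
  move=> cf x Ax; apply: continuous_comp; first exact: cf.
  by apply: differentiable_continuous; exact: ex_diff.
move=> [df Df]; split=> [x Ax|v].
  apply: differentiable_comp; first exact: df.
  exact: ex_diff.
apply: Ck_on_ext (IH _ (Df v)) => // x; rewrite inE => Ax /=.
have dlx : differentiable l (f x) by exact: ex_diff.
have dfx : differentiable f x by exact: df.
rewrite !deriveE //; last exact: differentiable_comp.
have dE : 'd l (f x) = l :> (W -> W') by exact: diff_val.
by rewrite [in RHS]diff_comp //= dE.
Qed.

Lemma Ck_on_sum (R : realType) (V W : normedModType R) k (A : set V) m
    (f : 'I_m -> V -> W) : open A ->
  (forall i, Ck_on k A (f i)) -> Ck_on k A (fun x => \sum_i f i x).
Proof.
move=> oA; elim: k f => [|k IH] f.
  move=> cf x Ax; apply: cvg_big => [z|i _]; last exact: cf.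
  by apply: cvgD; [exact: cvg_fst|exact: cvg_snd].
have sE (F : 'I_m -> V -> W) : (fun x => \sum_i F i x) = \sum_i F i.
  by apply/funext => x; rewrite fct_sumE.
move=> df; split=> [x Ax|v].
  by rewrite sE; apply: differentiable_sum => i; exact: (df i).1.
apply: Ck_on_ext (IH _ (fun i => (df i).2 v)) => // x; rewrite inE => Ax.
rewrite [in RHS]sE derive_sum // => i.
by apply: diff_derivable; exact: (df i).1.
Qed.

Lemma smooth_on_mx (R : realType) (V : normedModType R) (A : set V) m n
    (f : V -> 'M[R]_(m, n)) : open A ->
  (forall i j, smooth_on A (fun x => f x i j : R)) -> smooth_on A f.
Proof.
move=> oA sf k.
have -> : f = (fun x => \sum_i \sum_j f x i j *: delta_mx i j).
  by apply/funext => x; rewrite [LHS]matrix_sum_delta.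
apply: Ck_on_sum => // i; apply: Ck_on_sum => // j.
have dl (r : R) : is_diff r (fun r : R => r *: (delta_mx i j : 'M[R]_(m, n)))
    (fun r => r *: delta_mx i j) by exact: is_diff_scalel.
exact: (Ck_on_comp_linr oA dl (sf i j k)).
Qed.

(** * The bilinear form behind the leading term of the Lagrangian *)

Definition hform (R : pzSemiRingType) p n (H : 'M[R]_p) (G : 'M[R]_n)
    (v w : 'M[R]_(p, n)) : R :=
  \sum_al \sum_be \sum_i \sum_j H al be * G i j * v al i * w be j.

(** Symmetry of both [H] and [G] makes the form symmetric, which merges the two cross terms into
    one. *)
Lemma hform_line (R : comPzRingType) p n (H : 'M[R]_p) (G : 'M[R]_n)
    (v w : 'M[R]_(p, n)) (s : R) : H^T = H -> G^T = G ->
  hform H G (v + s *: w) (v + s *: w) =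
    hform H G v v + s * (2 * hform H G v w) + s ^+ 2 * hform H G w w.
Proof.
move=> Hsym Gsym.
have sym : hform H G w v = hform H G v w.
  rewrite /hform exchange_big; apply: eq_bigr => al _; apply: eq_bigr => be _.
  rewrite exchange_big; apply: eq_bigr => i _; apply: eq_bigr => j _.
  by rewrite -[in RHS]Hsym -[in RHS]Gsym !mxE; ring.
have -> : s * (2 * hform H G v w) = s * hform H G v w + s * hform H G w v.
  by rewrite sym; ring.
rewrite /hform !mulr_sumr -!big_split; apply: eq_bigr => al _ /=.
rewrite !mulr_sumr -!big_split; apply: eq_bigr => be _ /=.
rewrite !mulr_sumr -!big_split; apply: eq_bigr => i _ /=.
rewrite !mulr_sumr -!big_split; apply: eq_bigr => j _ /=.
by rewrite !mxE; ring.
Qed.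

Lemma sum_delta_mx (R : pzSemiRingType) p n (U : 'I_p -> 'I_n -> R) al i :
  \sum_be \sum_j U be j * (delta_mx al i : 'M[R]_(p, n)) be j = U al i.
Proof.
rewrite (bigD1 al) //= (bigD1 i) //= mxE !eqxx mulr1.
rewrite !big1 ?addr0 // => [be bal|j ji].
  by rewrite big1 // => j _; rewrite mxE (negPf bal) mulr0.
by rewrite mxE (negPf ji) andbF mulr0.
Qed.

Lemma hform_delta (R : comPzRingType) p n (H : 'M[R]_p) (G : 'M[R]_n)
    (v : 'M[R]_(p, n)) be j :
  hform H G v (delta_mx be j) = \sum_al \sum_i H al be * G i j * v al i.
Proof.
rewrite /hform; apply: eq_bigr => al _; rewrite exchange_big /=.
apply: eq_bigr => i _.
by rewrite (sum_delta_mx (fun be j => H al be * G i j * v al i)).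
Qed.

Lemma hform_sum (R : comPzRingType) p n (H : 'M[R]_p) (G : 'M[R]_n)
    (v w : 'M[R]_(p, n)) :
  hform H G v w = \sum_be \sum_j w be j * hform H G v (delta_mx be j).
Proof.
rewrite /hform exchange_big; apply: eq_bigr => be _ /=.
transitivity (\sum_al \sum_j \sum_i H al be * G i j * v al i * w be j).
  by apply: eq_bigr => al _; rewrite exchange_big.
rewrite exchange_big; apply: eq_bigr => j _ /=.
rewrite -/(hform _ _ _ _) hform_delta mulr_sumr; apply: eq_bigr => al _.
by rewrite mulr_sumr; apply: eq_bigr => i _; ring.
Qed.

(** * Vertical directions in jet coordinates *)

Lemma fibre_line (R : realType) p n (z0 : 'rV[R]_p * 'rV[R]_n)
    (v w : 'M[R]_(p, n)) (s : R) :
  (z0, v) + s *: (0, 0, w) = (z0, v + s *: w) :> jspace R p n.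
Proof.
case: z0 => t x; apply/eqP; rewrite !xpair_eqE /=.
by rewrite !scaler0 !addr0 !eqxx.
Qed.

Lemma fibre_add (R : realType) p n (z0 : 'rV[R]_p * 'rV[R]_n)
    (v w : 'M[R]_(p, n)) : (z0, v) + (0, 0, w) = (z0, v + w) :> jspace R p n.
Proof. by rewrite -[X in _ + X]scale1r fibre_line scale1r. Qed.

Lemma vdir_sum (R : realType) p n (w : 'M[R]_(p, n)) :
  (0, 0, w) = \sum_al \sum_i w al i *: vdir R al i :> jspace R p n.
Proof.
have D (u v : 'M[R]_(p, n)) :
    (0, 0, u + v) = (0, 0, u) + (0, 0, v) :> jspace R p n.
  by apply/eqP; rewrite !xpair_eqE /= !addr0 !eqxx.
have morph := big_morph (fun u => (0, 0, u) : jspace R p n) D (erefl 0).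
rewrite [w in LHS]matrix_sum_delta morph; apply: eq_bigr => al _.
rewrite morph; apply: eq_bigr => i _.
by apply/eqP; rewrite !xpair_eqE /= !scaler0 !eqxx.
Qed.

Lemma derive_vertical (R : realType) p n (F : jspace R p n -> R) z w :
  differentiable F z ->
  'D_(0, 0, w) F z = \sum_al \sum_i w al i * 'D_(vdir R al i) F z.
Proof.
move=> dF; rewrite deriveE // vdir_sum linear_sum; apply: eq_bigr => al _.
rewrite linear_sum; apply: eq_bigr => i _.
by rewrite linearZ deriveE.
Qed.

(** * From a factorised Hessian to a quadratic polynomial, on a single fibre *)

Section Fibre.
Variables (R : realType) (p n : nat) (f : jspace R p n -> R).
Variables (z0 : 'rV[R]_p * 'rV[R]_n) (H : 'M[R]_p).
Variable G : 'M[R]_(p, n) -> 'M[R]_n.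
Hypothesis H_unit : H \in unitmx.
Hypothesis f_diff : forall v : 'M[R]_(p, n), differentiable f (z0, v).
Hypothesis df_diff : forall al i (v : 'M[R]_(p, n)),
  differentiable ('D_(vdir R al i) f) (z0, v).
Hypothesis hess_f : forall al be i j v,
  'D_(vdir R al i) ('D_(vdir R be j) f) (z0, v) = 2 * (invmx H al be * G v i j).

Lemma hess_factor_row mu (v w : 'M[R]_(p, n)) :
  (forall i, w mu i = 0) -> G (v + w) = G v.
Proof.
move=> w0; apply/matrixP => i j.
(* Contracting with [H] cancels the factor [invmx H] of the Hessian and leaves a Kronecker delta in
   the row index: only row [mu] matters to [Phi]. *)
pose Phi := \sum_be H be mu *: ('D_(vdir R be j) f : jspace R p n -> R).
have dPhi u : differentiable Phi (z0, u).
  by apply: differentiable_sum => be; apply: differentiableZ.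
have DPhi al k u : 'D_(vdir R al k) Phi (z0, u) = (al == mu)%:R * (2 * G u k j).
  rewrite /Phi derive_sum => [|be]; last first.
    by apply: derivableZ; apply: diff_derivable.
  under eq_bigr do [rewrite deriveZ ?hess_f; last exact: diff_derivable].
  transitivity ((invmx H *m H) al mu * (2 * G u k j)).
    2: by rewrite mulVmx // mxE.
  rewrite mxE mulr_suml; apply: eq_bigr => be _.
  by rewrite [LHS]/GRing.scale /=; ring.
have PhiE u : Phi (z0, u + w) = Phi (z0, u).
  have := @line_constant _ _ Phi (z0, u) (0, 0, w).
  rewrite fibre_add; apply=> s; rewrite fibre_line //.
  rewrite derive_vertical // big1 // => al _; rewrite big1 // => k _.
  rewrite DPhi; case: eqP => [->|_]; last by rewrite mul0r mulr0.
  by rewrite w0 mul0r.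
have lineE u : (fun s : R => Phi ((z0, u) + s *: vdir R mu i)) =
    (fun s => Phi (z0, u + s *: delta_mx mu i)).
  by apply/funext => s; rewrite fibre_line.
(* Two equal functions of [s] have equal derivatives at 0; by [DPhi] these are twice the entries of
   [G] at [v + w] and at [v]. *)
have /(congr1 (fun k : R -> R => 'D_1 k 0)) :
    (fun s : R => Phi ((z0, v + w) + s *: vdir R mu i)) =
    (fun s : R => Phi ((z0, v) + s *: vdir R mu i)).
  by rewrite !lineE; apply/funext => s; rewrite addrAC PhiE.
rewrite !derive_line !scale0r !addr0 !DPhi eqxx !mul1r.
by apply: mulfI; rewrite pnatr_eq0.
Qed.

Lemma hess_factor_const v w : (1 < p)%N -> G v = G w.
Proof.
move=> p_gt1.
(* The path from [w] to [v] has two legs: [u] is the difference with row 1 erased, so the first leg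
   fixes row 1; the second leg moves row 1 alone and so fixes row 0. *)
pose mu : 'I_p := Ordinal p_gt1.
pose u := \matrix_(al, i) (if al == mu then 0 else (v - w) al i).
rewrite -(@hess_factor_row mu w u) => [|i]; last by rewrite mxE eqxx.
rewrite -(@hess_factor_row (Ordinal (ltnW p_gt1)) (w + u) (v - w - u)).
  by rewrite addrCA !addrA; congr G; apply/matrixP => k l; rewrite !mxE; ring.
by move=> i; rewrite !mxE /=; ring.
Qed.

(** Two integrations along the ray from the zero matrix: a constant Hessian makes each first
    derivative affine on the fibre, and then [f] quadratic. *)
Lemma hess_const_quadratic v : H^T = H -> (forall w, (G w)^T = G w) ->
    (forall u w, G u = G w) ->
  f (z0, v) = hform (invmx H) (G v) v v
    + \sum_al \sum_i 'D_(vdir R al i) f (z0, 0) * v al i + f (z0, 0).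
Proof.
move=> Hsym Gsym Gc.
have Df be j u : 'D_(vdir R be j) f (z0, u) =
    'D_(vdir R be j) f (z0, 0) + 2 * hform (invmx H) (G v) u (delta_mx be j).
  have := @line_quadratic _ _ ('D_(vdir R be j) f) (z0, 0) (0, 0, u)
    (2 * hform (invmx H) (G v) u (delta_mx be j)) 0.
  rewrite fibre_add add0r addr0.
  apply=> s; rewrite fibre_line // derive_vertical // mulr0 mul0rn addr0.
  rewrite hform_delta mulr_sumr; apply: eq_bigr => al _.
  rewrite mulr_sumr; apply: eq_bigr => i _.
  by rewrite hess_f (Gc _ v); ring.
have := @line_quadratic _ _ f (z0, 0) (0, 0, v)
  (\sum_al \sum_i 'D_(vdir R al i) f (z0, 0) * v al i)
  (hform (invmx H) (G v) v v).
rewrite fibre_add add0r => ->.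
- by rewrite addrC [f _ + _]addrC addrA.
- by move=> s; rewrite fibre_line.
move=> s; rewrite fibre_line derive_vertical // add0r.
have -> : s * hform (invmx H) (G v) v v *+ 2 =
    \sum_al \sum_i s * 2 * (v al i * hform (invmx H) (G v) v (delta_mx al i)).
  rewrite [X in s * X]hform_sum -mulr_natr mulr_sumr mulr_suml.
  apply: eq_bigr => al _; rewrite mulr_sumr mulr_suml; apply: eq_bigr => i _.
  by rewrite /=; ring.
rewrite -big_split; apply: eq_bigr => al _ /=.
rewrite -big_split; apply: eq_bigr => i _ /=.
have homo : hform (invmx H) (G v) (s *: v) (delta_mx al i) =
    s * hform (invmx H) (G v) v (delta_mx al i).
  rewrite !hform_delta mulr_sumr; apply: eq_bigr => be _.
  by rewrite mulr_sumr; apply: eq_bigr => j _; rewrite mxE; ring.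
by rewrite Df homo; ring.
Qed.

End Fibre.

(** The formula for [f] is given only on the fibre over [z0]; this suffices because vertical
    directions stay in that fibre. Reading off linear coefficients twice gives the Hessian. *)
Lemma hess_quadratic (R : realType) p n (f : jspace R p n -> R)
    (z0 : 'rV[R]_p * 'rV[R]_n) (H : 'M[R]_p) (G : 'M[R]_n) (U : 'M[R]_(p, n))
    (c : R) al be i j v : H^T = H -> G^T = G ->
  (forall v, f (z0, v) = hform H G v v + \sum_al \sum_i U al i * v al i + c) ->
  'D_(vdir R al i) ('D_(vdir R be j) f) (z0, v) = 2 * (H al be * G i j).
Proof.
move=> Hsym Gsym fE.
have Df u : 'D_(vdir R be j) f (z0, u) =
    2 * hform H G u (delta_mx be j) + U be j.
  apply: (@derive_of_line_quadratic _ _ _ _ _ _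
    (hform H G (delta_mx be j) (delta_mx be j))) => s.
  rewrite fibre_line !fE hform_line // mulrDr.
  have -> : \sum_al \sum_i U al i * (u + s *: delta_mx be j) al i =
      \sum_al \sum_i U al i * u al i + s * U be j.
    rewrite -[U be j](sum_delta_mx (fun al i => U al i)) mulr_sumr -big_split.
    apply: eq_bigr => ga _; rewrite mulr_sumr -big_split; apply: eq_bigr => k _.
    by rewrite /= !mxE; ring.
  ring.
apply: (@derive_of_line_quadratic _ _ _ _ _ _ 0) => s.
rewrite fibre_line !Df mulr0 addr0 !hform_delta.
rewrite -[H al be * G i j](sum_delta_mx (fun al i => H al be * G i j)).
rewrite addrAC; congr (_ + _).
rewrite !mulr_sumr -big_split; apply: eq_bigr => ga _ /=.
rewrite !mulr_sumr -big_split; apply: eq_bigr => k _ /=.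
by rewrite !mxE; ring.
Qed.

(** * Fibres of the jet bundle and its zero section in charts *)

Section Jets.
Variables (R : realType) (p n : nat).
Variables (T : smooth_manifold R p) (M : smooth_manifold R n).
Implicit Types (a : chart T) (b : chart M) (y : jet1 T M).

Lemma open_jimg a b : open (@jimg R p n T M a b).
Proof.
have -> : @jimg R p n T M a b =
    (fst \o fst) @^-1` cimg a `&` (snd \o fst) @^-1` cimg b by [].
apply: openI; apply: open_comp; [|exact: cimg_open| |exact: cimg_open].
  by move=> z _; apply: continuous_comp; exact: cvg_fst.
by move=> z _; apply: continuous_comp; [exact: cvg_fst|exact: cvg_snd].
Qed.

Lemma jdom_jpt a b z : jimg a b z -> jdom a b (jpt a b z).
Proof.
by case: z => -[_ _] v [/= [t at_ <-] [x bx <-]]; split; rewrite /= crdK.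
Qed.

Definition jbase a b y : 'rV[R]_p * 'rV[R]_n :=
  (crd a (jsrc y), crd b (jtgt y)).

(** [jimg] puts no constraint on the matrix component, so the vertical lines used above never leave
    the coordinate domain. *)
Lemma jimg_fibre a b y v : jdom a b y -> jimg a b (jbase a b y, v).
Proof. by case=> ay by_; split; [exists (jsrc y)|exists (jtgt y)]. Qed.

Lemma jsrc_fibre a b y v : jdom a b y ->
  jsrc (jpt a b (jbase a b y, v)) = jsrc y.
Proof. by case=> ay _; rewrite /= crdK. Qed.

Lemma jtgt_fibre a b y v : jdom a b y ->
  jtgt (jpt a b (jbase a b y, v)) = jtgt y.
Proof. by case=> _ by_; rewrite /= crdK. Qed.

Lemma jmx_fibre a b y v : jdom a b y -> jmx (jpt a b (jbase a b y, v)) a b = v.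
Proof. by move=> yD; have /(congr1 snd) := jptK (jimg_fibre v yD). Qed.

(** The zero section: the law of change is linear in the matrix, so 0 in all charts is consistent,
    and restricting [L] to it gives a chart-free [F]. *)
Definition zero_jet (t : T) (x : M) : jet1 T M.
Proof.
apply: (@Jet1 _ _ _ T M t x (fun _ _ => 0)) => //.
by move=> a a' b b' _ _ _ _; rewrite mulmx0 mul0mx.
Defined.

Lemma jpt_zero a b z : jpt a b (z, 0) = zero_jet (cpt a z.1) (cpt b z.2).
Proof.
apply: jet1_eq => //=; apply/funext => a'; apply/funext => b'.
by rewrite /jpt_mx mulmx0 mul0mx; case: ifP.
Qed.

Lemma jpt_fibre_zero a b y : jdom a b y ->
  jpt a b (jbase a b y, 0) = zero_jet (jsrc y) (jtgt y).
Proof. by case=> ay by_; rewrite jpt_zero /= !crdK. Qed.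

Section Lagrangian.
Variables (h : semi_riemannian_metric T) (L : jet1 T M -> R).

(** * Consequences of regularity: the expansion of the Lagrangian and the tensoriality of its linear
    part *)

Section Regular.
Variable (g : chart T -> chart M -> jet1 T M -> 'M[R]_n).
Hypothesis p_gt1 : (1 < p)%N.
Hypothesis L_smooth : jet_smooth L.
Hypothesis g_sym : forall a b y, jdom a b y -> (g a b y)^T = g a b y.
Hypothesis L_regular : forall a b y, jdom a b y -> forall al be i j,
  vertical_metric L a b y al be i j = invmx (h a (jsrc y)) al be * g a b y i j.

Let gfib a b y v := g a b (jpt a b (jbase a b y, v)).

Lemma regular_diff a b y v : jdom a b y ->
  differentiable (L \o jpt a b) (jbase a b y, v).
Proof. by move=> yD; apply: (L_smooth a b 1).1; exact: jimg_fibre. Qed.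

Lemma regular_derive_diff a b y al i v : jdom a b y ->
  differentiable ('D_(vdir R al i) (L \o jpt a b)) (jbase a b y, v).
Proof. by move=> yD; apply: ((L_smooth a b 2).2 _).1; exact: jimg_fibre. Qed.

Lemma regular_hess a b y al be i j v : jdom a b y ->
  'D_(vdir R al i) ('D_(vdir R be j) (L \o jpt a b)) (jbase a b y, v) =
    2 * (invmx (h a (jsrc y)) al be * gfib a b y v i j).
Proof.
move=> yD; have yvD := jdom_jpt (jimg_fibre v yD).
have := L_regular yvD al be i j.
rewrite /vertical_metric jptK ?jsrc_fibre //; last exact: jimg_fibre.
by move=> <-; rewrite mulrA mulfV ?mul1r // pnatr_eq0.
Qed.

Lemma regular_gfib_const a b y v w : jdom a b y -> gfib a b y v = gfib a b y w.
Proof.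
move=> yD; have := yD => -[ay _].
apply: (@hess_factor_const _ _ _ (L \o jpt a b) (jbase a b y) _ _
  (metric_nondegenerate h ay)) p_gt1.
- by move=> al i u; exact: regular_derive_diff.
- by move=> al be i j u; exact: regular_hess.
Qed.

Lemma regular_base_only : base_only g.
Proof.
move=> a b y y' yD y'D et ex.
rewrite -(jcrdK yD) -(jcrdK y'D) /jcrd -et -ex.
exact: regular_gfib_const yD.
Qed.

Definition linear_part a b y : 'M[R]_(p, n) :=
  \matrix_(al, i) 'D_(vdir R al i) (L \o jpt a b) (jbase a b y, 0).

(** This is [hess_const_quadratic] on the fibre through [y], evaluated at the coordinates of [y];
    its constant term is the value of [L] on the zero section. *)
Lemma regular_expansion a b y : jdom a b y ->
  L y = hform (invmx (h a (jsrc y))) (g a b y) (jmx y a b) (jmx y a b)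
    + \sum_al \sum_i linear_part a b y al i * jmx y a b al i
    + L (zero_jet (jsrc y) (jtgt y)).
Proof.
move=> yD; have := yD => -[ay _].
have := @hess_const_quadratic _ _ _ (L \o jpt a b) (jbase a b y)
  (h a (jsrc y)) (gfib a b y) (fun v => regular_diff v yD)
  (fun al i v => regular_derive_diff al i v yD)
  (fun al be i j v => regular_hess al be i j v yD)
  (jmx y a b) (Defs.metric_sym h ay).
rewrite /= -[X in jpt a b X]/(jcrd a b y) jpt_fibre_zero // /gfib jcrdK //.
move=> ->.
- congr (_ + _ + _); apply: eq_bigr => al _; apply: eq_bigr => i _.
  by rewrite mxE.
- by move=> w; apply: g_sym; apply: jdom_jpt; exact: jimg_fibre.
- by move=> u w; exact: regular_gfib_const.
Qed.

Lemma linear_part_base_only : base_only linear_part.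
Proof. by move=> a b y y' _ _ et ex; rewrite /linear_part /jbase et ex. Qed.

(* The left-hand side does not mention the charts: this makes the linear part
   tensorial without differentiating a change of coordinates. *)
Lemma regular_odd a b y y' : jdom a b y -> jsrc y = jsrc y' ->
    jtgt y = jtgt y' -> jmx y' a b = - jmx y a b ->
  L y - L y' = 2 * \sum_al \sum_i linear_part a b y al i * jmx y a b al i.
Proof.
move=> yD et ex ev.
have y'D : jdom a b y' by rewrite /jdom /= -et -ex.
rewrite (regular_expansion yD) (regular_expansion y'D) -et -ex.
rewrite -(linear_part_base_only yD y'D et ex).
rewrite -(regular_base_only yD y'D et ex) ev.
set H := invmx _; set v := jmx y a b.
have -> : hform H (g a b y) (- v) (- v) = hform H (g a b y) v v.
  rewrite /hform; do 4 (apply: eq_bigr => ? _).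
  by rewrite !mxE; ring.
have -> : \sum_al \sum_i linear_part a b y al i * (- v) al i =
    - \sum_al \sum_i linear_part a b y al i * v al i.
  rewrite -sumrN; apply: eq_bigr => al _; rewrite -sumrN; apply: eq_bigr => i _.
  by rewrite [(- v) al i]mxE mulrN.
by ring.
Qed.

(** The jets [u] and [u'] over the base point of [y] have opposite coordinates [d] and [- d], hence
    opposite coordinates in the other chart too. Expressing [L u - L u'] by [regular_odd] in both
    charts and comparing gives the law; the elementary matrix [d] singles out one entry. *)
Lemma linear_part_change a a' b b' y : jdom a b y -> jdom a' b' y ->
  forall al i, linear_part a b y al i =
    \sum_be \sum_j linear_part a' b' y be j * cjac b b' (jtgt y) i j
                     * cjac a' a (jsrc y) be al.
Proof.
move=> yD y'D al i.
pose d : 'M[R]_(p, n) := delta_mx al i.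
pose u := jpt a b (jbase a b y, d); pose u' := jpt a b (jbase a b y, - d).
have eu : (jsrc u = jsrc y) * (jtgt u = jtgt y).
  by rewrite /u jsrc_fibre ?jtgt_fibre.
have eu' : (jsrc u' = jsrc y) * (jtgt u' = jtgt y).
  by rewrite /u' jsrc_fibre ?jtgt_fibre.
have uD c e : jdom c e y -> jdom c e u by case=> ? ?; split; rewrite eu.
have u'D c e : jdom c e y -> jdom c e u' by case=> ? ?; split; rewrite eu'.
have change w : jsrc w = jsrc y -> jtgt w = jtgt y -> jmx w a' b' =
    cjac a' a (jsrc y) *m jmx w a b *m cjac b b' (jtgt y).
  move=> et ex; case: yD y'D => ay by_ [ay' by'].
  by rewrite -et -ex; apply: jmx_change; rewrite ?et ?ex.
have es : jsrc u = jsrc u' by rewrite eu eu'.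
have ex : jtgt u = jtgt u' by rewrite eu eu'.
have ud : jmx u a b = d by rewrite jmx_fibre.
have u'd : jmx u' a b = - jmx u a b by rewrite ud jmx_fibre.
have u'd' : jmx u' a' b' = - jmx u a' b'.
  by rewrite !change ?eu ?eu' // u'd mulmxN mulNmx.
have := regular_odd (uD _ _ yD) es ex u'd.
rewrite (regular_odd (uD _ _ y'D) es ex u'd') ud sum_delta_mx.
rewrite -(linear_part_base_only yD (uD _ _ yD)) ?eu //.
rewrite -(linear_part_base_only y'D (uD _ _ y'D)) ?eu // change ?eu // ud.
move=> /(mulfI _) <-; last by rewrite pnatr_eq0.
(* What remains is that a product of two Jacobians around [d] has as entry (be, j) a single product
   of Jacobian entries. *)
apply: eq_bigr => be _; apply: eq_bigr => j _; rewrite -mulrA; congr (_ * _).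
rewrite mxE (bigD1 i) //= big1 ?addr0 => [|k ki].
  rewrite mxE (bigD1 al) //= big1 ?addr0 => [|k kal].
    by rewrite [d al i]mxE !eqxx mulr1 mulrC.
  by rewrite [d k i]mxE (negPf kal) mulr0.
rewrite mxE big1 ?mul0r // => l _.
by rewrite [d l k]mxE (negPf ki) andbF mulr0.
Qed.

End Regular.
End Lagrangian.

(** * Smoothness of the linear part and of the restriction to the zero section *)

Lemma is_diff_zero_section (z : 'rV[R]_p * 'rV[R]_n) :
  is_diff z (fun z => (z, 0) : jspace R p n) (fun z => (z, 0)).
Proof.
exact: (is_diff_pair (is_diff_id _) (is_diff_cst (0 : 'M[R]_(p, n)) _)).
Qed.

Lemma is_diff_zero_fibre (z : jspace R p n) :
  is_diff z (fun z => (z.1, 0) : jspace R p n) (fun z => (z.1, 0)).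
Proof.
have cfst : continuous (fst : jspace R p n -> _) by move=> ?; exact: cvg_fst.
have dfst : is_diff z (fst : jspace R p n -> _) fst.
  by apply: DiffDef; [exact: linear_differentiable|exact: diff_lin].
exact: (is_diff_pair dfst (is_diff_cst (0 : 'M[R]_(p, n)) _)).
Qed.

Lemma linear_part_smooth (L : jet1 T M -> R) a b : jet_smooth L ->
  jet_smooth_on a b (linear_part L a b).
Proof.
move=> sL; apply: smooth_on_mx => [|al i k]; first exact: open_jimg.
apply: (@Ck_on_ext _ _ _ _ _
    ('D_(vdir R al i) (L \o jpt a b) \o (fun z => (z.1, 0)))).
- exact: open_jimg.
- move=> z; rewrite inE => zD /=; rewrite mxE.
  have /(congr1 fst) /= ez := jptK zD.
  by rewrite /jbase ez.
(* The entry is a first derivative of [L] pulled back by projection to the zero section, so class k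
   of the entry uses class k + 1 of [L]. *)
- exact: (Ck_on_comp_linl (open_jimg (b := b)) is_diff_zero_fibre
            ((sL a b k.+1).2 _)).
Qed.

Lemma zero_jet_smooth (L : jet1 T M -> R) : jet_smooth L ->
  base_smooth (fun z => L (zero_jet z.1 z.2)).
Proof.
move=> sL a b k.
have -> : (fun z : 'rV[R]_p * 'rV[R]_n =>
      L (zero_jet (cpt a z.1) (cpt b z.2))) =
    (L \o jpt a b) \o (fun z => (z, 0)).
  by apply/funext => z; rewrite /= jpt_zero.
exact: (Ck_on_comp_linl (open_jimg (b := b)) is_diff_zero_section (sL a b k)).
Qed.

(** * The two implications *)

Lemma kronecker_regular_electrodynamics (h : semi_riemannian_metric T)
    (L : jet1 T M -> R) : (1 < p)%N -> jet_smooth L ->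
  kronecker_regular h L -> electrodynamics h L.
Proof.
move=> p_gt1 sL [g [dg [gsym grk gsig] gL]].
exists g, (linear_part L), (fun z => L (zero_jet z.1 z.2)); split.
- by split=> //; exact: (regular_base_only p_gt1 sL gL).
- split; last exact: linear_part_base_only.
  split=> [a b|a a' b b' y yD y'D]; first exact: linear_part_smooth.
  exact: (linear_part_change p_gt1 sL gsym gL).
- exact: zero_jet_smooth.
- by move=> a b y yD; exact: (regular_expansion p_gt1 sL gsym gL).
Qed.

(** The same [g] works: since [g] and [U] depend on the base point only, their values at [y] are the
    coefficients of [L] along the whole fibre through [y], and [hess_quadratic] applies. *)
Lemma electrodynamics_kronecker_regular (h : semi_riemannian_metric T)
    (L : jet1 T M -> R) : electrodynamics h L -> kronecker_regular h L.
Proof.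
move=> [g [U [F [[dg gb [gsym grk gsig]] [_ Ub] _ LE]]]].
exists g; split=> // a b y yD al be i j; have := yD => -[ay _].
rewrite /vertical_metric -[jcrd a b y]/(jbase a b y, jmx y a b).
rewrite (@hess_quadratic _ _ _ _ _ (invmx (h a (jsrc y))) (g a b y) (U a b y)
  (F (jsrc y, jtgt y))) ?gsym //.
- by rewrite mulKf // pnatr_eq0.
- by rewrite trmx_inv Defs.metric_sym.
move=> v; have yvD := jdom_jpt (jimg_fibre v yD).
rewrite /= (LE a b) // jsrc_fibre // jtgt_fibre // jmx_fibre //.
by rewrite -(gb _ _ _ _ yD yvD) ?jsrc_fibre ?jtgt_fibre // -(Ub _ _ _ _ yD yvD)
  ?jsrc_fibre ?jtgt_fibre.
Qed.

End Jets.

Theorem theorem2p1 (R : realType) (p n : nat) (hp : (2 <= p)%N)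
    (T : smooth_manifold R p) (M : smooth_manifold R n)
    (h : semi_riemannian_metric T) (L : jet1 T M -> R) (hL : jet_smooth L) :
  kronecker_regular h L <-> electrodynamics h L.
Proof.
split; first exact: kronecker_regular_electrodynamics.
exact: electrodynamics_kronecker_regular.
Qed.
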